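(* Let $G$ be a finite non-abelian group, let $H$ be a subgroup of $G$ with $H \neq Z(H,G)$, and let $g \in K(H,G)$. Let $x \in H$ be any vertex of $\Gamma_{H,G}^g$, and let $\deg(x)$ denote its degree in $\Gamma_{H,G}^g$. Then: (a) If $g = 1$, then $\deg(x) = |G| - |C_G(x)|$. (b) If $g \neq 1$ and $g^2 \neq 1$, then $\deg(x) = |G| - |C_G(x)| - 1$ if $x$ is conjugate in $G$ to exactly one of $xg$ and $xg^{-1}$, and $\deg(x) = |G| - 2|C_G(x)| - 1$ if $x$ is conjugate in $G$ to both $xg$ and $xg^{-1}$. (c) If $g \neq 1$ and $g^2 = 1$, then $\deg(x) = |G| - |C_G(x)| - 1$ whenever $x$ is conjugate in $G$ to $xg$.
   Context: For $x,y$ in a group, $[x,y] = x^{-1}y^{-1}xy$. For a subgroup $H$ of $G$: $Z(H,G) = \{x \in H : xy = yx \text{ for all } y \in G\}$ and $K(H,G) = \{[x,y] : x \in H,\ y \in G\}$. $C_G(x) = \{y \in G : xy = yx\}$. The relative $g$-noncommuting graph $\Gamma_{H,G}^g$ is the simple undirected graph with vertex set $G$ in which two distinct vertices $x,y$ are adjacent if and only if ($x \in H$ or $y \in H$) and $[x,y] \neq g$ and $[x,y] \neq g^{-1}$. *)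

(* Defs.v *)
From mathcomp Require Import all_boot all_order all_algebra all_fingroup.

Set Implicit Arguments.
Unset Strict Implicit.
Unset Printing Implicit Defensive.

Local Open Scope group_scope.

Section RelativeNoncommutingGraph.

Variables (gT : finGroupType) (G H : {set gT}) (g : gT).

(* Adjacency in Gamma_{H,G}^g, as a relation on the ambient type gT; the
   vertex set is G, so elements outside G are adjacent to nothing. *)
Definition rel_nc_adj : rel gT := fun x y =>
  [&& x \in G, y \in G, x != y, (x \in H) || (y \in H),
      [~ x, y] != g & [~ x, y] != g^-1].

Definition rel_nc_deg (x : gT) : nat := #|[set y in G | rel_nc_adj x y]|.

Lemma rel_nc_adj_irrefl : irreflexive rel_nc_adj.
Proof. by move=> x; rewrite /rel_nc_adj eqxx /= !andbF. Qed.

Lemma rel_nc_adj_sym : symmetric rel_nc_adj.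
Proof.
move=> x y; rewrite /rel_nc_adj -(invg_comm y x) eqg_inv (inv_eq invgK).
by rewrite [y == x]eq_sym orbC; do 2!case: (_ \in G) => //=;
   rewrite [(_ != g^-1) && _]andbC.
Qed.

End RelativeNoncommutingGraph.

(* Main.v *)
Require Import Defs.
From mathcomp Require Import all_boot all_order all_algebra all_fingroup.
From mathcomp Require Import zify.

Local Open Scope group_scope.

(** Since [~ x, y] = x^-1 * x ^ y, the equation [~ x, y] = h says that y
    conjugates x to x * h.  Hence the vertices of G that are not neighbours of
    an x in H are x itself and the y that conjugate x to x * g or to x * g^-1.

    The y in G conjugating x to a given z form the empty set when z is not
    conjugate to x, and otherwise a right coset of the centraliser of x
    ([card_conj_fibre]).  The degree is therefore |G| minus the size of a union
    of two such fibres, minus one more for x when x is in neither fibre.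
    - If g = 1, both fibres are the centraliser itself, which contains x.
    - If g <> 1, neither fibre contains x, because x ^ x = x.  The fibres over
      x * g and x * g^-1 coincide when g ^+ 2 = 1 and are disjoint otherwise;
      each contributes 0 or the order of the centraliser. *)

Definition conj_fibre {gT : finGroupType} (G : {set gT}) (x z : gT) : {set gT} :=
  [set y in G | x ^ y == z].

Lemma commg_eq_conj {gT : finGroupType} (x y h : gT) :
  ([~ x, y] == h) = (x ^ y == x * h).
Proof. by rewrite -(inj_eq (mulgI x)) commgEl mulKVg. Qed.

Lemma conj_fibre_id {gT : finGroupType} (G : {group gT}) (x : gT) :
  conj_fibre G x x = 'C_G[x].
Proof. by apply/setP=> y; rewrite !inE conjg_set1 sub1set inE. Qed.

(** Two elements conjugating x to the same z differ on the left by an element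
    centralising x, so a nonempty fibre is a right coset of the centraliser. *)
Lemma card_conj_fibre {gT : finGroupType} (G : {group gT}) (x z : gT) :
  #|conj_fibre G x z| = (if z \in x ^: G then #|'C_G[x]| else 0)%N.
Proof.
case: imsetP => [[a aG ->] | zNx].
  rewrite -(card_rcoset 'C_G[x] a) -conj_fibre_id; apply: eq_card => y.
  by rewrite mem_rcoset !inE groupMr ?groupV // conjgM (canF_eq (conjgKV a)).
apply: eq_card0 => y; rewrite inE; apply/negP=> /andP[yG /eqP xyz].
by case: zNx; exists y.
Qed.

Lemma disjoint_conj_fibre {gT : finGroupType} (G : {set gT}) (x z t : gT) :
  z != t -> conj_fibre G x z :&: conj_fibre G x t = set0.
Proof.
move=> zNt; apply/setP=> y; rewrite !inE.
by case: (x ^ y =P z) => [->|]; rewrite ?(negbTE zNt) ?andbF.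
Qed.

Lemma rel_nc_neighboursE {gT : finGroupType} (G H : {group gT}) (g x : gT) :
    H \subset G -> x \in H ->
  [set y in G | rel_nc_adj G H g x y] =
  G :\: (x |: (conj_fibre G x (x * g) :|: conj_fibre G x (x * g^-1))).
Proof.
move=> sHG xH; have xG := subsetP sHG x xH.
apply/setP=> y; rewrite !inE /rel_nc_adj xG xH !commg_eq_conj eq_sym /=.
by case: (y \in G); rewrite ?andbF //= !negb_or andbT.
Qed.

(** x, conjugating x to itself, lies in neither fibre when g <> 1, whence the
    extra 1; stated additively to avoid truncated subtraction. *)
Lemma rel_nc_deg_neq1 {gT : finGroupType} (G H : {group gT}) (g x : gT) :
    H \subset G -> x \in H -> g != 1 ->
  (rel_nc_deg G H g x
    + #|conj_fibre G x (x * g) :|: conj_fibre G x (x * g^-1)|.+1 = #|G|)%N.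
Proof.
move=> sHG xH gN1; have xG := subsetP sHG x xH.
rewrite /rel_nc_deg rel_nc_neighboursE //.
set F := conj_fibre _ _ _ :|: _.
have xNF : x \notin F.
  by rewrite !inE xG conjgE mulKg !(eq_mulVg1 x) !mulKg eq_invg1 (negbTE gN1).
have sFG : x |: F \subset G.
  by rewrite subUset sub1set xG subUset /=; apply/andP; split;
    apply/subsetP=> y; rewrite inE => /andP[].
rewrite -[RHS](cardsID (x |: F) G) addnC (setIidPr sFG).
by rewrite cardsU1 xNF add1n.
Qed.

Theorem theorem2p1 (gT : finGroupType) (G H : {group gT}) (g x : gT)
    (nabG : ~~ abelian G)
    (sHG : H \subset G)
    (HneqZ : H <> 'C_H(G) :> {set gT})
    (gK : g \in commg_set H G)
    (xH : x \in H) :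
  [/\ (* (a) *)
      g = 1 ->
        ((rel_nc_deg G H g x)%:Z = #|G|%:Z - #|'C_G[x]|%:Z)%R,
      (* (b) *)
      g <> 1 -> g ^+ 2 <> 1 ->
        ((x * g \in x ^: G) (+) (x * g^-1 \in x ^: G) ->
           ((rel_nc_deg G H g x)%:Z = #|G|%:Z - #|'C_G[x]|%:Z - 1)%R) /\
        ((x * g \in x ^: G) && (x * g^-1 \in x ^: G) ->
           ((rel_nc_deg G H g x)%:Z = #|G|%:Z - 2 * #|'C_G[x]|%:Z - 1)%R)
    & (* (c) *)
      g <> 1 -> g ^+ 2 = 1 ->
        x * g \in x ^: G ->
        ((rel_nc_deg G H g x)%:Z = #|G|%:Z - #|'C_G[x]|%:Z - 1)%R].
Proof.
split.
- move=> g1; rewrite /rel_nc_deg rel_nc_neighboursE //.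
  (* For g = 1 both fibres lie over x, and x already belongs to them. *)
  rewrite g1 invg1 mulg1 setUid conj_fibre_id (setUidPr _); last first.
    by rewrite sub1set inE (subsetP sHG) //= cent1id.
  rewrite -(cardsID 'C_G[x] G) (setIidPr (subsetIl _ _)).
  by rewrite PoszD GRing.addrC GRing.addKr.
- move=> /eqP gN1 /eqP g2N1.
  have xgN : x * g != x * g^-1.
    by rewrite (inj_eq (mulgI x)) eq_sym eq_invg_mul.
  have := rel_nc_deg_neq1 G H g x sHG xH gN1.
  rewrite cardsU disjoint_conj_fibre // cards0 subn0 !card_conj_fibre.
  case: (x * g \in _); case: (x * g^-1 \in _) => /= degE; split=> // _; lia.
- move=> /eqP gN1 /eqP g2_1 xgG.
  have gV : g^-1 = g by apply/eqP; rewrite eq_invg_mul.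
  have := rel_nc_deg_neq1 G H g x sHG xH gN1.
  rewrite gV setUid card_conj_fibre xgG; lia.
Qed.
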